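(* Let $\pi=\{2,3\}$, let $L=\operatorname{GL}_3(2)$, let $V$ be the natural $3$-dimensional $\mathbb{F}_2L$-module, and let $G$ be the nonsplit extension of $V$ by $L$, that is, $V\trianglelefteq G$, $G/V\cong L$, the conjugation action of $G$ induces on $V$ the natural $\mathbb{F}_2L$-module structure, and $V$ has no complement in $G$. Then $G$ is a minimal nonsolvable group with Frattini subgroup $\Phi(G)=V$. If $H$ is a $2$-Sylow subgroup of $L$, then $H$ is $\pi$-submaximal in $L$, but there is no $\pi$-submaximal subgroup of $G$ whose image under the canonical epimorphism $G\to G/\Phi(G)\cong L$ equals $H$.
   Context: All groups are finite. For a set of primes $\pi$, a $\pi$-subgroup of a finite group is a subgroup whose order is divisible only by primes in $\pi$. A subgroup is $\pi$-maximal if it is a $\pi$-subgroup and is not contained in a strictly larger $\pi$-subgroup. A subgroup $H$ of a finite group $G$ is $\pi$-submaximal in $G$ if there exists a finite group $G^*$ into which $G$ can be embedded as a subnormal subgroup (identify $G$ with its image) such that $H=G\cap K$ for some $\pi$-maximal subgroup $K$ of $G^*$. A group is minimal nonsolvable if it is not solvable but all its proper subgroups are solvable. The nonsplit extension of $V$ by $L$ with the stated action exists and is unique up to isomorphism, since $\dim H^2(L,V)=1$. *)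

(* Defs.v *)
From mathcomp Require Import all_boot all_order all_fingroup all_algebra all_solvable.

Set Implicit Arguments.
Unset Strict Implicit.
Unset Printing Implicit Defensive.

Local Open Scope group_scope.

Definition pi_maximal (pi : nat_pred) (gT : finGroupType) (G K : {group gT}) : bool :=
  [max K | pi.-subgroup(G) K].

(* [Gs] and [i] are the overgroup G* and the embedding of G into it; [Gs] may
   live in any finite group type, not only in [gT]. *)
Definition pi_submaximal (pi : nat_pred) (gT : finGroupType) (G H : {group gT}) : Prop :=
  H \subset G /\
  exists (rT : finGroupType) (Gs K : {group rT}) (i : {morphism G >-> rT}),
    [/\ 'injm i, i @* G <|<| Gs, pi_maximal pi Gs K & i @* H = i @* G :&: K].

Definition minimal_nonsolvable (gT : finGroupType) (G : {group gT}) : Prop :=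
  ~~ solvable G /\ forall M : {group gT}, M \proper G -> solvable M.

(* Main.v *)
Require Import Defs.
From mathcomp Require Import all_boot all_order all_fingroup all_algebra all_solvable.
From mathcomp Require Import all_character.

Set Implicit Arguments.
Unset Strict Implicit.
Unset Printing Implicit Defensive.

Local Open Scope group_scope.

(** Write L = GL_3(2).  Orders alone show that proper subgroups of L are
    solvable, and a solvable normal subgroup of L would be elementary abelian of
    order divisible by 7 (L is transitive on the 7 nonzero vectors), hence of
    order 7, which is impossible; so L is simple.  As V is irreducible and not
    complemented, V M = G forces M = G: thus G is minimal nonsolvable, perfect,
    and Phi(G) = V = O_2(G).

    The pi-subgroups of L strictly above a Sylow 2-subgroup H have order 24 and
    fix a nonzero row vector or a nonzero column vector, but not both.  The
    inverse-transpose automorphism, followed by a suitable inner one, stabilises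
    H and exchanges the two kinds, so inside Aut L no pi-subgroup containing H
    and (an odd power of) this automorphism meets L in more than H.

    No such exchange is possible for G, because the action on V = O_2(G) tells
    the two kinds apart.  Suppose G is subnormal in X and K is pi-maximal in X,
    with K :&: G =: S mapping onto a Sylow 2-subgroup.  Then V <= O_2(X) <= K, so
    S has order 64 and P := C_G(C_V(S)), the preimage of the stabiliser of a
    vector, has order 192; moreover P is normalised by N_K(G).  The K-conjugates
    of G commute modulo O_2(X) or coincide, so the K-conjugates of P generate
    modulo O_2(X) a pi-group normalised by K, and P <= K by maximality: a
    contradiction, as P is not contained in S. *)

(** * Perfect subnormal subgroups *)

Section PerfectSubnormal.

Variable gT : finGroupType.
Implicit Types A B N P Q K X Y : {group gT}.

(** By induction, [A] lies in a proper normal [Y] and centralises [N :&: Y], which contains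
    [[~: N, A]]. So [[~: N, A, A] = 1], and the three subgroup lemma makes [[~: A, A] = A]
    centralise [N]. *)
Lemma subnormal_cent_perfect A N X :
  A^`(1) = A -> A <|<| X -> N <| X -> A :&: N = 1 -> A \subset 'C(N).
Proof.
move=> perfA; move: {2}#|X|.+1 (ltnSn #|X|) => n.
elim: n X N => // n IHn X N leXn snAX nsNX tiAN.
case: (subnormalEr snAX) => [defA | [Y [snAY nsYX prYX]]].
  have nsNA : N <| A by rewrite defA.
  have -> : N :=: 1 by rewrite -tiAN; apply/esym/setIidPr/normal_sub.
  exact: cents1.
have sAY := subnormal_sub snAY.
have cA_NY : A \subset 'C(N :&: Y).
  apply: (IHn Y (N :&: Y)%G) => //=.
  - exact: leq_trans (proper_card prYX) leXn.
  - by rewrite /= setIC; apply: normalGI (normal_sub nsYX) nsNX.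
  - by apply/trivgP; rewrite -tiAN setIS // subsetIl.
have nNX := normal_norm nsNX; have nYX := normal_norm nsYX.
have sNA_NY : [~: N, A] \subset N :&: Y.
  rewrite subsetI commg_subl (subset_trans sAY) ?(subset_trans (normal_sub nsYX)) //=.
  rewrite (subset_trans (commgS _ sAY)) // commg_subr.
  exact: subset_trans (normal_sub nsNX) nYX.
have NAA : [~: N, A, A] = 1.
  by apply/commG1P/(subset_trans sNA_NY); rewrite centsC.
have ANA : [~: A, N, A] = 1 by rewrite (commGC A N).
have := three_subgroup ANA NAA.
have -> : [~: A, A] = A by rewrite -[RHS]perfA.
by move/commG1P.
Qed.

(** If [A] lies in a proper normal [N], then [B :&: N] is either trivial, and the previous lemma
    applies, or all of [B], and both groups descend to [N]. *)
Lemma subnormal_simple_commute A B X :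
    A^`(1) = A -> B^`(1) = B ->
    (forall N, N <| A -> N :=: 1 \/ N :=: A) ->
    (forall N, N <| B -> N :=: 1 \/ N :=: B) ->
  A <|<| X -> B <|<| X -> A :=: B \/ A \subset 'C(B).
Proof.
move=> perfA perfB simA simB.
move: {2}#|X|.+1 (ltnSn #|X|) => n.
elim: n X => // n IHn X leXn snAX snBX.
case: (subnormalEr snAX) => [defA | [N [snAN nsNX prNX]]].
  case: (subnormalEr snBX) => [defB | [N [snBN nsNX prNX]]].
    by left; rewrite defA.
  right; case: (simA N); rewrite ?defA // => defN.
    have := subnormal_sub snBN; rewrite defN => /trivgP->; exact: cents1.
  by move: prNX; rewrite defN properxx.
have nsBN : B :&: N <| B := normalGI (subnormal_sub snBX) nsNX.
case: (simB (B :&: N)%G nsBN) => /= defBN.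
  right; apply: subset_trans (subnormal_sub snAN) _; rewrite centsC.
  exact: subnormal_cent_perfect snBX nsNX defBN.
apply: (IHn N) => //; first exact: leq_trans (proper_card prNX) leXn.
by rewrite -defBN; apply: setI_subnormal snBX; apply: normal_sub.
Qed.

(** Let [Y] be proper normal and contain [A]. Modulo [Y] the perfect [B] lies in the solvable image
    of [Q], so [B \subset Y]; the modular law then replaces [Q] by [Q :&: Y]. *)
Lemma perfect_sub_mul_solvable A B Q X :
    B^`(1) = B -> A <|<| X -> Q <| X -> solvable Q -> B \subset A * Q ->
  B \subset A.
Proof.
move=> perfB snAX nsQX solQ; move: {2}#|X|.+1 (ltnSn #|X|) => n.
elim: n X Q snAX nsQX solQ => // n IHn X Q snAX nsQX solQ leXn sBAQ.
have sBX : B \subset X.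
  by apply: subset_trans sBAQ _; rewrite mul_subG ?(subnormal_sub snAX) ?normal_sub.
case: (subnormalEr snAX) => [-> // | [Y [snAY nsYX prYX]]].
have sAY := subnormal_sub snAY.
have nYX := normal_norm nsYX.
have sBYQ : B \subset Y * Q by apply: subset_trans sBAQ (mulSg _ sAY).
have sBY : B \subset Y.
  have nYB : B \subset 'N(Y) := subset_trans sBX nYX.
  rewrite -quotient_sub1 //.
  have solB : solvable (B / Y).
    apply: solvableS (quotient_sol Y solQ).
    by rewrite /= -(quotientMidl Y Q); apply: quotientS.
  have := sol_der1_proper solB (subxx _).
  have -> : (B / Y)^`(1) = B / Y by rewrite -quotient_der // perfB.
  rewrite properxx; case: eqP => [-> // | _ /(_ isT) //].
apply: (IHn Y (Q :&: Y)%G) => //=.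
- by rewrite setIC; apply: normalGI (normal_sub nsYX) nsQX.
- exact: solvableS (subsetIl _ _) solQ.
- exact: leq_trans (proper_card prYX) leXn.
by rewrite group_modl // subsetI sBAQ sBY.
Qed.

Lemma subnormal_sub_pcore pi A X :
  A <|<| X -> 'O_pi(A) \subset 'O_pi(X).
Proof.
move: {2}#|X|.+1 (ltnSn #|X|) => n.
elim: n X => // n IHn X leXn snAX.
case: (subnormalEr snAX) => [-> // | [Y [snAY nsYX prYX]]].
have /subset_trans->// := IHn Y (leq_trans (proper_card prYX) leXn) snAY.
by rewrite -(pcore_setI_normal pi nsYX) subsetIl.
Qed.

End PerfectSubnormal.

(** * Maximal pi-subgroups and conjugates of a perfect subnormal subgroup *)

Section PerfectSubnormalMaximal.

Variables (gT : finGroupType) (p : nat) (pi : nat_pred).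
Implicit Types A B N P Q K X Y : {group gT}.

Lemma subnormalJ A X x : x \in X -> A <|<| X -> A :^ x <|<| X.
Proof.
move=> Xx snAX; have := morphim_subnormal (conjgm_morphism X x) snAX.
by rewrite !morphim_conj setIid (setIidPr (subnormal_sub snAX)) (conjGid Xx).
Qed.

(** For [A] not a [p]-group: [A / 'O_p(A)] is simple and no proper normal subgroup of [A]
    supplements ['O_p(A)]. *)
Definition simple_mod_pcore A := forall N, N <| A -> p.-group N \/ N :=: A.

Lemma quotient_pcore_simple A X :
    simple_mod_pcore A -> A <|<| X ->
  forall N : {group coset_of 'O_p(X)},
    N <| A / 'O_p(X) -> N :=: 1 \/ N :=: A / 'O_p(X).
Proof.
move=> simA snAX N nsNA.
have nQA : A \subset 'N('O_p(X)).
  exact: subset_trans (subnormal_sub snAX) (gFnorm _ _).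
have sNA := normal_sub nsNA.
pose M := (A :&: coset 'O_p(X) @*^-1 N)%G.
have defN : M / 'O_p(X) = N.
  by rewrite quotientIG ?cosetpreK ?(setIidPr sNA) // sub_cosetpre.
have nsMA : M <| A.
  rewrite /normal subsetIl normsI ?normG //.
  by apply: norm_quotient_pre => //; apply: normal_norm.
case: (simA M nsMA) => [pM | defM]; last by right; rewrite -defN defM.
left; rewrite -defN quotientS1 //.
apply: subset_trans (subnormal_sub_pcore p snAX).
exact: pcore_max.
Qed.

Lemma simple_mod_pcoreJ A x : simple_mod_pcore A -> simple_mod_pcore (A :^ x)%G.
Proof.
move=> simA N nsN; have := simA (N :^ x^-1)%G.
rewrite -(normalJ _ _ x) /= conjsgKV => /(_ nsN)[]; first by rewrite pgroupJ; left.
by move=> defA; right; rewrite -defA conjsgKV.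
Qed.

(** The groups [P :^ x <*> 'O_p(X)], for [x] in [K], normalise one another, so they generate a
    [pi]-group normalised by [K], which maximality puts inside [K]. *)
Theorem pi_maximal_sub_of_norm A K P X :
    p \in pi -> A^`(1) = A -> simple_mod_pcore A -> A <|<| X ->
    [max K | pi.-subgroup(X) K] ->
    P \subset A -> pi.-group P -> 'N_K(A) \subset 'N(P) ->
  P \subset K.
Proof.
move=> pi_p perfA simA snAX maxK sPA piP nPK.
have /andP[sKX piK] := maxgroupp maxK.
set Q := 'O_p(X); have nsQX : Q <| X := pcore_normal p X.
have nQX := normal_norm nsQX.
have piQ : pi.-group Q := pi_pgroup (pcore_pgroup p X) pi_p.
have sAX := subnormal_sub snAX.
have perfAJ x : (A :^ x)^`(1) = A :^ x by rewrite derJ perfA.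
have sAJX x : x \in K -> A :^ x \subset X.
  by move=> Kx; apply/subnormal_sub/subnormalJ; rewrite ?(subsetP sKX).
have sPJX x : x \in K -> P :^ x \subset X.
  by move=> Kx; apply: subset_trans (sAJX x Kx); rewrite conjSg.
have nPP j k : j \in K -> k \in K -> P :^ j \subset 'N(P :^ k <*> Q).
  move=> Kj Kk.
  have snJ x : x \in K -> A :^ x <|<| X.
    by move=> Kx; apply: subnormalJ; rewrite ?(subsetP sKX).
  have nQAJ x : x \in K -> A :^ x \subset 'N(Q).
    by move=> Kx; apply: subset_trans nQX; apply: sAJX.
  have perfQ x : x \in K -> (A :^ x / Q)^`(1) = A :^ x / Q.
    by move=> Kx; rewrite -quotient_der ?perfAJ ?nQAJ.
  have nQPJ x : x \in K -> P :^ x \subset 'N(Q).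
    by move=> Kx; apply: subset_trans nQX; apply: sPJX.
  have [eqA | cA] := subnormal_simple_commute (perfQ j Kj) (perfQ k Kk)
      (quotient_pcore_simple (simple_mod_pcoreJ (x := j) simA) (snJ j Kj))
      (quotient_pcore_simple (simple_mod_pcoreJ (x := k) simA) (snJ k Kk))
      (quotient_subnormal _ (snJ j Kj)) (quotient_subnormal _ (snJ k Kk)).
    (* Equal images modulo the solvable [Q] force equal conjugates, as these are perfect; then
       [j * k^-1] normalises [A], hence [P]. *)
    have sAjk : A :^ j \subset A :^ k.
      apply: perfect_sub_mul_solvable (perfAJ j) (snJ k Kk) nsQX _ _.
        exact: pgroup_sol (pcore_pgroup p X).
      by rewrite normC ?nQAJ // -quotientSK ?eqA ?nQAJ.
    have eqAjk : A :^ j = A :^ k.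
      by apply/eqP; rewrite eqEcard sAjk !cardJg leqnn.
    have NKjk : j * k^-1 \in 'N_K(A).
      by rewrite inE groupM ?groupV //; apply/normP; rewrite conjsgM eqAjk conjsgK.
    have -> : P :^ j = P :^ k.
      by rewrite -[j](mulgKV k) conjsgM (normP (subsetP nPK _ NKjk)).
    exact: subset_trans (joing_subl _ _) (normG _).
  rewrite joingC -quotientYK ?nQPJ //; apply: norm_quotient_pre; first exact: nQPJ.
  apply: subset_trans (cent_sub _).
  apply: subset_trans (quotientS _ _) (subset_trans cA (centS (quotientS _ _))).
    by rewrite conjSg.
  by rewrite conjSg.
pose D := (P <*> Q)%G.
have DJ x : x \in K -> D :^ x = P :^ x <*> Q.
  move=> Kx; rewrite -genJ conjUg; congr <<_ :|: _>>.
  exact: (normsP nQX) (subsetP sKX x Kx).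
pose R := <<class_support D K>>.
have sDJR x : x \in K -> D :^ x \subset R.
  by move=> Kx; rewrite sub_gen // class_supportEr (bigcup_max x).
have sRX : R \subset X.
  rewrite gen_subG class_supportEr; apply/bigcupsP=> x Kx.
  by rewrite DJ // join_subG sPJX ?normal_sub.
have piD : pi.-group D.
  by rewrite /= norm_joinEl ?pgroupM ?piP // (subset_trans sPA) ?(subset_trans sAX).
have nDR x : x \in K -> R \subset 'N(D :^ x).
  move=> Kx; rewrite gen_subG class_supportEr; apply/bigcupsP=> y Ky.
  rewrite !DJ // join_subG nPP // (subset_trans _ (normG _)) //.
  exact: joing_subr.
(* Each [D :^ x] is a normal [pi]-subgroup of [R], so it lies in ['O_pi(R)]. *)
have piR : pi.-group R.
  apply: pgroupS (pcore_pgroup pi R); rewrite gen_subG {1}class_supportEr.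
  apply/bigcupsP=> x Kx; apply: (@pcore_max _ _ _ (D :^ x)%G).
    by rewrite pgroupJ.
  by apply/andP; split; [apply: sDJR | apply: nDR].
have nRK : K \subset 'N(R) by rewrite norms_gen // class_support_norm.
have sRK : R \subset K by apply: comm_sub_max_pgroup maxK _ _ _ => //; apply/esym/normC.
apply: subset_trans sRK; apply: subset_trans (sDJR 1 (group1 K)).
by rewrite conjsg1 joing_subl.
Qed.

End PerfectSubnormalMaximal.

(** * The group GL_3(2) *)

Section GL32.

Import GRing.Theory.

Local Notation L := 'GL_3(2).
Local Notation row3 := 'rV['F_2]_3.
Implicit Types (u v w : row3) (g h : {'GL_3['F_2]}).

Definition row_act u g : row3 := (u *m GLval g)%R.

Fact row_act1 : row_act^~ 1 =1 id.
Proof. by move=> u; rewrite /row_act mulmx1. Qed.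

Fact row_actM u : act_morph row_act u.
Proof. by move=> g h; rewrite /row_act mulmxA. Qed.

Canonical row_action := TotalAction row_act1 row_actM.

Local Notation "'RA" := row_action (at level 0) : action_scope.

Lemma GL_of_unitmx (A : 'M['F_2]_3) : A \in unitmx -> {g : {'GL_3['F_2]} | GLval g = A}.
Proof. by move=> uA; exists (FinRing.unit 'M['F_2]_3 uA). Qed.

(** A nonzero row has rank 1, so Gaussian elimination makes [u] a scalar multiple of the first row
    of the invertible [row_ebase u]. *)
Lemma row_delta u : u != 0%R -> exists g, row_act (delta_mx 0 0)%R g = u.
Proof.
move=> nzu.
have rk1 : \rank u = 1%N.
  by apply/eqP; rewrite eqn_leq rank_leq_row lt0n mxrank_eq0.
have nzc : ((col_ebase u) 0 0 != 0)%R.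
  have := col_ebase_unit u; rewrite [col_ebase u]mx11_scalar unitmxE det_scalar1.
  by rewrite mxE eqxx mulr1n unitfE.
have [g def_g] := @GL_of_unitmx (col_ebase u 0 0 *: row_ebase u)%R
  ltac:(by rewrite unitmxZ ?unitfE ?row_ebase_unit).
exists g; rewrite /row_act def_g -scalemxAr scalemxAl -mul_scalar_mx -mx11_scalar.
rewrite -[RHS]mulmx_ebase rk1; congr (_ *m _ *m _)%R.
apply/matrixP=> i j; rewrite !mxE !ord1 /= eq_sym andbT.
by case: j => [[|j] ltj].
Qed.

Lemma row_transitive u v : u != 0%R -> v != 0%R -> exists g, row_act u g = v.
Proof.
move=> /row_delta[g <-] /row_delta[h <-]; exists (g^-1 * h).
by rewrite -row_actM mulKVg.
Qed.

Lemma card_GL32 : #|L| = 168.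
Proof.
by rewrite card_GL // card_Fp // unlock.
Qed.

Lemma card_row3 : #|{: row3}| = 8.
Proof. by rewrite card_mx card_Fp. Qed.

Lemma row_act_eq0 u g : (row_act u g == 0%R) = (u == 0%R).
Proof.
apply/eqP/eqP=> [|->]; last exact: mul0mx.
by move/(congr1 (row_act^~ g^-1)); rewrite -row_actM mulgV row_act1 [RHS]mul0mx.
Qed.

Lemma row_orbit u : u != 0%R -> orbit 'RA L u = [set~ 0%R].
Proof.
move=> nzu; apply/setP=> v; rewrite !inE; apply/orbitP/idP=> [[g _ <-]|nzv].
  by rewrite /= row_act_eq0.
by have [g <-] := row_transitive nzu nzv; exists g; rewrite ?inE.
Qed.

Lemma card_row_stab u : u != 0%R -> #|'C_L[u | 'RA]| = 24.
Proof.
move=> nzu; have := card_orbit_stab 'RA L u; rewrite row_orbit // cardsC1 card_row3.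
by move=> /= def; apply/eqP; rewrite -(eqn_pmul2l (isT : 0 < 7)) def card_GL32.
Qed.

Lemma row_act_faithful g : (forall u, u != 0%R -> row_act u g = u) -> g = 1.
Proof.
move=> fix_g; apply: val_inj; apply/row_matrixP=> i; rewrite rowE.
rewrite -[RHS]/(row i 1%:M) row1; apply: fix_g.
by apply/eqP=> /matrixP/(_ 0%R i)/eqP; rewrite !mxE !eqxx.
Qed.

End GL32.

(** * Simplicity of [GL_3(2)] and solvability of its proper subgroups *)

Lemma index_cent_cyclic (gT : finGroupType) (G H : {group gT}) :
  cyclic H -> G \subset 'N(H) -> #|G : 'C_G(H)| <= totient #|H|.
Proof.
move=> cycH nHG; rewrite -card_Aut_cyclic //.
have <- : #|conj_aut H @* G| = #|G : 'C_G(H)|.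
  by rewrite card_morphim ker_conj_aut (setIidPr nHG) indexgI.
by rewrite subset_leq_card ?Aut_conj_aut.
Qed.

(** These are the proper divisors of 168 with three distinct prime factors. The Sylow 7-subgroup is
    unique by counting, and its quotient has order 6 or 12. *)
Lemma solvable_card_42_84 (gT : finGroupType) (G : {group gT}) :
  #|G| \in [:: 42; 84] -> solvable G.
Proof.
move=> oG.
have chk : all (fun m => all (fun n => (n %% 7 == 1%N) ==> (n == 1%N)) (divisors m))
  [:: 42; 84] by vm_compute.
have := allP (allP chk _ oG) #|'Syl_7(G)|.
rewrite -dvdn_divisors ?cardG_gt0 // card_Syl_dvd card_Syl_mod // => /(_ isT).
case/normal_sylowP=> T sylT nsTG; rewrite (series_sol nsTG).
have oT := card_Hall sylT.
have solT : solvable T := pgroup_sol (pHall_pgroup sylT).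
rewrite solT /= ; apply: Burnside_p_a_q_b.
rewrite card_quotient ?normal_norm // -divgS ?normal_sub // oT p_part.
by move: oG; rewrite !inE => /orP[] /eqP->; vm_compute.
Qed.

Section GL32Subgroups.

Local Notation L := 'GL_3(2).
Local Notation "'RA" := row_action (at level 0) : action_scope.
Implicit Types M N T E : {group {'GL_3['F_2]}}.

Lemma sub_GL32 (A : {set {'GL_3['F_2]}}) : A \subset L.
Proof. exact: subsetT. Qed.

Lemma nz_row3 : exists u : 'rV['F_2]_3, (u != 0)%R.
Proof.
by exists (delta_mx 0 0)%R; apply/eqP=> /matrixP/(_ 0 0)%R/eqP; rewrite !mxE.
Qed.

(** By order, a vector stabiliser [S] satisfies [S * T = L]. An element of [S] centralising [T]
    fixes the whole orbit of [u], so [S], of order 24, would act faithfully on [T], which has only 6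
    automorphisms. *)
Lemma not_normal_card7_GL32 T : T <| L -> #|T| <> 7.
Proof.
move=> /normal_norm nTL oT; have [u nzu] := nz_row3.
set S := ('C_L[u | 'RA])%G; have oS : #|S| = 24 := card_row_stab nzu.
have nTS : S \subset 'N(T) := subset_trans (sub_GL32 S) nTL.
have defL : S * T = L.
  apply/eqP; rewrite eqEcard sub_GL32 -[#|L|]/#|'GL_3(2)%G| card_GL32.
  by rewrite coprime_cardMg ?oS ?oT.
have cST1 : 'C_S(T) = 1.
  apply/trivgP/subsetP=> c /setIP[Sc cTc]; rewrite inE; apply/eqP.
  apply: row_act_faithful => v nzv; have [g <-] := row_transitive nzu nzv.
  have : g \in S * T by rewrite defL inE.
  case/mulsgP=> s t /setIP[_ /astab1P us] Tt -> .
  have uc : row_act u c = u by case/setIP: Sc => _ /astab1P.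
  have us' : row_act u s = u by [].
  by rewrite !row_actM us' -!row_actM -(centP cTc t Tt) row_actM uc.
have pT : cyclic T by apply: prime_cyclic; rewrite oT.
have := index_cent_cyclic pT nTS.
by rewrite cST1 indexg1 oS oT.
Qed.

Lemma card_sub_GL32 M : #|M| \in divisors 168.
Proof. by rewrite -dvdn_divisors // -card_GL32 cardSg ?sub_GL32. Qed.

Lemma solvable_proper_GL32 M : M \proper L -> solvable M.
Proof.
rewrite properEcard sub_GL32 card_GL32 => /= ltM.
have chk : all (fun n => [|| 168 <= n, size (primes n) <= 2 | n \in [:: 42; 84]])
  (divisors 168) by vm_compute.
have /or3P[] := allP chk _ (card_sub_GL32 M); first by rewrite leqNgt ltM.
  exact: Burnside_p_a_q_b.
exact: solvable_card_42_84.
Qed.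

(** Some [c] in [N] moves a vector [u], so the stabiliser [S] of [u] is proper in [S <*> N]; the
    only divisors of 168 that are multiples of 24 are 24 and 168. *)
Lemma dvdn7_normal_GL32 N : N <| L -> N :!=: 1 -> 7 %| #|N|.
Proof.
move=> nsNL /trivgPn[c Nc ntc].
have [u nzu uc] : exists2 u, u != 0%R & row_act u c != u.
  apply/exists_inP; apply: contraR ntc => /exists_inPn fix_c.
  apply/eqP/row_act_faithful => u nzu; apply/eqP; have := fix_c u nzu.
  by rewrite negbK.
set S := ('C_L[u | 'RA])%G; have oS : #|S| = 24 := card_row_stab nzu.
have nNS : S \subset 'N(N) := subset_trans (sub_GL32 S) (normal_norm nsNL).
have oSN := mul_cardG S N.
rewrite -norm_joinEl //= in oSN.
have dvS : 24 %| #|S <*> N| by rewrite -oS cardSg ?joing_subl.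
have chk : all (fun n => (24 %| n) ==> (n == 24) || (7 %| n)) (divisors 168).
  by vm_compute.
have := allP chk _ (card_sub_GL32 (S <*> N)%G); rewrite dvS /=.
case/orP=> [/eqP oSN24 | dv7].
  have eqS : S :=: S <*> N.
    by apply/eqP; rewrite eqEcard joing_subl oSN24 /= -oS.
  have : c \in S by rewrite eqS (subsetP (joing_subr S N)).
  by case/setIP=> _ /astab1P uc'; rewrite -[row_act u c]/('RA%act u c) uc' eqxx in uc.
have : 7 %| #|S| * #|N| by rewrite oSN dvdn_mulr.
by rewrite oS Euclid_dvdM.
Qed.

Lemma nonsolvable_normal_GL32 N : N <| L -> N :!=: 1 -> ~~ solvable N.
Proof.
move=> nsNL ntN; apply/negP=> solN.
have [E minE sEN] : {E : {group _} | minnormal E L & E \subset N}.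
  by apply: mingroup_exists; rewrite ntN normal_norm.
have [nEL ntE /is_abelemP[p pr_p /abelem_pgroup pE]] :=
  minnormal_solvable minE sEN solN.
have nsEL : E <| L by rewrite /normal sub_GL32.
have dv7 := dvdn7_normal_GL32 nsEL ntE.
have p7 : p = 7.
  by apply/esym/eqP; apply: (pnatP _ _ pE); rewrite ?cardG_gt0.
apply: (not_normal_card7_GL32 nsEL); apply/eqP; rewrite p7 in pE.
have chk : all (fun n => (7 %| n) ==> 7.-nat n ==> (n == 7)) (divisors 168).
  by vm_compute.
by have := allP chk _ (card_sub_GL32 E); rewrite dv7 -[7.-nat _]/(7.-group E) pE.
Qed.

Lemma normal_GL32 N : N <| L -> N :=: 1 \/ N :=: L.
Proof.
move=> nsNL; have [-> | ntN] := eqVneq (N : {set _}) 1; first by left.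
have := nonsolvable_normal_GL32 nsNL ntN; right; apply/eqP; move: H.
by apply: contraR => neNL; rewrite solvable_proper_GL32 // properEneq neNL sub_GL32.
Qed.

Lemma GL32_neq1 : L != 1.
Proof. by apply/eqP=> L1; have := card_GL32; rewrite /= L1 cards1. Qed.

Lemma nonsolvable_GL32 : ~~ solvable L.
Proof. exact: nonsolvable_normal_GL32 (normal_refl _) GL32_neq1. Qed.

Lemma perfect_GL32 : L^`(1) = L.
Proof.
case: (normal_GL32 (der_normal 1 [group of L])) => //= /eqP L'1.
by have := nonsolvable_GL32; rewrite abelian_sol // /abelian; apply/commG1P/eqP.
Qed.

Lemma center_GL32 : 'Z(L) = 1.
Proof.
case: (normal_GL32 (center_normal [group of L])) => //= ZL.
have := center_abelian [group of L]; rewrite ZL => /abelian_sol.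
by rewrite (negPf nonsolvable_GL32).
Qed.

End GL32Subgroups.

(** * The inverse-transpose automorphism *)

(** A minimal normal subgroup is a 2-group or has order 3. In the latter case its centraliser [C]
    has index at most 2 and [C / 'Z(C)] is a 2-group, so [C] is nilpotent and its Sylow 2-subgroup
    is normal in [G]. *)
Lemma pcore2_card24 (gT : finGroupType) (G : {group gT}) :
  #|G| = 24 -> 'O_2(G) != 1.
Proof.
move=> oG; have solG : solvable G by apply: Burnside_p_a_q_b; rewrite oG.
have ntG : G :!=: 1 by apply/eqP=> G1; rewrite G1 cards1 in oG.
have [E minE sEG] : {E : {group _} | minnormal E G & E \subset G}.
  by apply: mingroup_exists; rewrite ntG normG.
have [nEG ntE /is_abelemP[p pr_p /abelem_pgroup pE]] :=
  minnormal_solvable minE sEG solG.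
have nsEG : E <| G by apply/andP.
have [p2 | p'2] := eqVneq p 2.
  rewrite p2 in pE; apply: contraNneq ntE => O1.
  by rewrite -subG1 -O1 pcore_max.
have oE : #|E| = 3.
  have p3 : p = 3.
    have : p %| 24.
      rewrite -oG; apply: dvdn_trans (cardSg sEG).
      by have [] := pgroup_pdiv pE ntE.
    rewrite (_ : 24 = 2 ^ 3 * 3)%N // Euclid_dvdM // Euclid_dvdX //.
    by rewrite !dvdn_prime2 // (negPf p'2) => /eqP.
  have chk : all (fun n => 3.-nat n ==> (n != 1%N) ==> (n == 3)) (divisors 24).
    by vm_compute.
  have := allP chk #|E|; rewrite -dvdn_divisors // -oG cardSg // => /(_ isT).
  rewrite p3 in pE; rewrite -[3.-nat _]/(3.-group E) pE -trivg_card1 ntE.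
  by move/eqP.
pose C := 'C_G(E)%G; have nsCG : C <| G by rewrite /normal subsetIl normsI ?normG ?norms_cent.
have sEZ : E \subset 'Z(C).
  have cEE : E \subset 'C(E) by rewrite -/(abelian E) cyclic_abelian // prime_cyclic // oE.
  by rewrite subsetI subsetI sEG cEE centsC subsetIr.
have dvC : 12 %| #|C|.
  have := index_cent_cyclic (prime_cyclic _) nEG; rewrite oE => /(_ isT).
  rewrite -/C => le2; have := Lagrange (normal_sub nsCG); rewrite oG => oC.
  have chk : all (fun i => (i <= 2) ==> (12 %| 24 %/ i)) (divisors 24) by vm_compute.
  have := allP chk #|G : C|; rewrite -dvdn_divisors // -{1}oC dvdn_mull // => /(_ isT).
  by rewrite le2 -{1}oC mulnK.
have nilC : nilpotent C.
  rewrite -quotient_center_nil; apply: (@pgroup_nil _ 2).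
  rewrite /pgroup card_quotient ?gFnorm //.
  have chk : all (fun n => (3 * n %| 24)%N ==> 2.-nat n) (divisors 24) by vm_compute.
  have dv : (3 * #|C : 'Z(C)| %| 24)%N.
    rewrite -oG -{1}oE; apply: dvdn_trans (cardSg (normal_sub nsCG)).
    by rewrite -(Lagrange (center_sub C)) dvdn_mul ?cardSg.
  have := allP chk #|C : 'Z(C)|; rewrite dv -dvdn_divisors //.
  by apply; apply: dvdn_trans dv; apply: dvdn_mull.
have hallO := nilpotent_pcore_Hall 2 nilC.
apply: contraTneq dvC => O1.
have : 'O_2(C) = 1.
  apply/trivgP; rewrite -O1 pcore_max ?pcore_pgroup //.
  by apply: gFnormal_trans.
move/(congr1 (fun A : {set _} => #|A|)); rewrite (card_Hall hallO) cards1 p_part.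
move/eqP; rewrite -[1%N]/(2 ^ 0)%N eqn_exp2l // => /eqP log0.
apply/negP=> dvC; have := dvdn_leq_log 2 (cardG_gt0 C) dvC.
by rewrite log0.
Qed.

Section GraphAutomorphism.

Import GRing.Theory.

Local Notation L := 'GL_3(2).
Local Notation row3 := 'rV['F_2]_3.
Local Notation "'RA" := row_action (at level 0) : action_scope.
Implicit Types (u v w : row3) (g h : {'GL_3['F_2]}) (A : {set {'GL_3['F_2]}}).
Implicit Types M N T E : {group {'GL_3['F_2]}}.

Fact inv_tr_unit g : (invmx (GLval g))^T%R \in unitmx.
Proof. by rewrite unitmx_tr unitmx_inv; apply: GL_unit. Qed.

Definition inv_tr g : {'GL_3['F_2]} := FinRing.unit 'M['F_2]_3 (inv_tr_unit g).

Lemma GLval_inv_tr g : GLval (inv_tr g) = (GLval g^-1)^T%R.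
Proof. by []. Qed.

Lemma inv_trM : {morph inv_tr : g h / g * h}.
Proof.
move=> g h; apply: val_inj.
rewrite /= -[invmx _]/(GLval (g * h)^-1) invMg GL_MxE trmx_mul.
by [].
Qed.

Lemma inv_trK : involutive inv_tr.
Proof.
move=> g; apply: val_inj; rewrite /= trmx_inv trmxK.
exact: invmxK.
Qed.

(** Applied to [inv_tr @: A], this says that [A] fixes a nonzero column vector. *)
Definition fixes_row A := [exists u, (u != 0%R) && [forall g in A, row_act u g == u]].

Lemma fixes_rowP A :
  reflect (exists2 u, u != 0%R & {in A, forall g, row_act u g = u}) (fixes_row A).
Proof.
apply: (iffP existsP) => [[u /andP[nzu /forall_inP fix_u]] | [u nzu fix_u]].
  by exists u => // g Ag; apply/eqP/fix_u.
by exists u; rewrite nzu; apply/forall_inP=> g Ag; apply/eqP/fix_u.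
Qed.

Lemma fixes_rowJ A g : fixes_row (A :^ g) = fixes_row A.
Proof.
wlog suff: A g / fixes_row A -> fixes_row (A :^ g) => [IH|].
  apply/idP/idP; last exact: IH.
  by move=> fixAg; rewrite -(conjsgK g A); apply: IH fixAg.
case/fixes_rowP=> u nzu fix_u; apply/fixes_rowP; exists (row_act u g).
  by rewrite row_act_eq0.
move=> _ /imsetP[h Ah ->]; rewrite -row_actM conjgE mulKVg row_actM.
by rewrite fix_u.
Qed.

Lemma F2_neq0_eq1 (c : 'F_2) : (c != 0 -> c = 1)%R.
Proof. by case: c => [[|[|c]] //= ltc] _; apply: val_inj. Qed.

(** Over [F_2] an invariant line has a single nonzero vector, which is therefore fixed. *)
Lemma rank1_fixes_row (W : 'M['F_2]_3) A :
    \rank W = 1%N -> (forall g, g \in A -> ((W *m GLval g)%R <= W)%MS) ->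
  fixes_row A.
Proof.
move=> rkW WA; have nzW : W != 0%R by rewrite -mxrank_eq0 rkW.
have nzu : nz_row W != 0%R by rewrite nz_row_eq0.
apply/fixes_rowP; exists (nz_row W) => // g Ag.
have rk_u : \rank (nz_row W) = 1%N by rewrite rank_rV nzu.
have sWu : (W <= nz_row W)%MS by rewrite -(geq_leqif (mxrank_leqif_sup (nz_row_sub W))) rkW rk_u.
have : (row_act (nz_row W) g <= nz_row W)%MS.
  apply: submx_trans sWu; apply: submx_trans (WA g Ag).
  exact: submxMr (nz_row_sub W).
case/sub_rVP=> c def_ug; rewrite def_ug (F2_neq0_eq1 (c := c)) ?scale1r //.
apply: contraNneq nzu => c0; rewrite -(row_act_eq0 _ g) def_ug c0 scale0r.
exact: eqxx.
Qed.

(** In characteristic 2 the fixed space of [E] is nonzero; it is proper since [E] acts faithfully,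
    and [M] stabilises it. An invariant line gives a fixed row, an invariant plane an invariant line
    in the dual. *)
Lemma fixes_row_norm_2group E M :
    2.-group E -> E :!=: 1 -> M \subset 'N(E) ->
  fixes_row M || fixes_row (inv_tr @: M).
Proof.
move=> pE ntE nEM.
have [U [U0 UM rkU]] : exists U : 'M['F_2]_3, [/\ U != 0%R,
    forall g, g \in M -> ((U *m GLval g)%R <= U)%MS & \rank U < 3].
  exists (rfix_mx (GLrepr 'F_2 2) E); split.
  - by apply: rfix_pgroup_pchar pE _; rewrite ?sub_GL32 // pchar_Fp.
  - move=> g Mg; have : g \in rstabs (GLrepr 'F_2 2) (rfix_mx (GLrepr 'F_2 2) E).
      rewrite (subsetP (norm_sub_rstabs_rfix_mx _ (sub_GL32 E))) //.
      by rewrite inE inE (subsetP nEM).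
    by rewrite inE => /andP[].
  rewrite ltn_neqAle rank_leq_row andbT; apply: contra ntE => rk3.
  rewrite -subG1; apply/subsetP=> x Ex; rewrite inE; apply/eqP/row_act_faithful => u _.
  by apply/rfix_mxP: x Ex; apply: submx_full; apply: rk3.
have rkU0 : 0 < \rank U by rewrite lt0n mxrank_eq0.
have [rk1 | rk2] : \rank U = 1%N \/ \rank U = 2.
  by move: rkU0 rkU; case: (\rank U) => [|[|[|m]]] //; [left | right].
  by rewrite (rank1_fixes_row rk1 UM).
apply/orP; right; apply: (@rank1_fixes_row (kermx U^T)).
  by rewrite mxrank_ker mxrank_tr rk2.
move=> _ /imsetP[g Mg ->]; apply/sub_kermxP.
have /submxP[D defU] := UM _ (groupVr Mg).
rewrite GLval_inv_tr -mulmxA -trmx_mul defU trmx_mul mulmxA.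
by rewrite mulmx_ker mul0mx.
Qed.

(** By order, [M] is the full stabiliser of [u], so it contains the transvection [1 + a b] as soon
    as [u a = 0]; with [b] nonzero on the column fixed by [M], that column is moved. *)
Lemma not_fixes_row_both M :
  #|M| = 24 -> fixes_row M -> fixes_row (inv_tr @: M) -> False.
Proof.
move=> oM /fixes_rowP[u nzu Mu] /fixes_rowP[v nzv Mv].
have defM : M :=: 'C_L[u | 'RA].
  apply/eqP; rewrite eqEcard card_row_stab // oM leqnn andbT.
  apply/subsetP=> g Mg; rewrite inE in_setT; apply/astab1P.
  exact: Mu.
have [j vj] : exists j, v 0%R j != 0%R.
  by apply/rV0Pn.
pose b : row3 := delta_mx 0%R j.
(* Two linear conditions on three coordinates; [b a = 0] makes [1 - a b] the inverse of
   [1 + a b]. *)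
have [a nza [ua ba]] : exists2 a : 'cV['F_2]_3, a != 0%R & (u *m a = 0)%R /\ (b *m a = 0)%R.
  pose C := kermx (col_mx u b)^T.
  have nzC : C != 0%R.
    rewrite -mxrank_eq0 mxrank_ker mxrank_tr -lt0n subn_gt0.
    exact: leq_ltn_trans (rank_leq_row _) _.
  exists (nz_row C)^T%R; first by rewrite trmx_eq0 nz_row_eq0.
  have /sub_kermxP/(congr1 trmx) := nz_row_sub C.
  rewrite trmx_mul trmxK trmx0 mul_col_mx => /eqP; rewrite col_mx_eq0.
  by case/andP=> /eqP-> /eqP->.
have [g defg] : {g : {'GL_3['F_2]} | GLval g = (1%:M + a *m b)%R}.
  apply: GL_of_unitmx.
  apply: (proj1 (@mulmx1_unit _ _ _ (1%:M - a *m b)%R _)).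
  rewrite mulmxBr mulmx1 mulmxDl mul1mx mulmxA -(mulmxA a) ba mulmx0 mul0mx addr0.
  by rewrite addrK.
have Mg : g \in M.
  rewrite defM inE in_setT; apply/astab1P.
  by rewrite /= /row_act defg mulmxDr mulmx1 mulmxA ua mul0mx addr0.
have := Mv _ (imset_f inv_tr (groupVr Mg)).
rewrite /row_act GLval_inv_tr invgK defg => /(congr1 trmx).
rewrite trmx_mul trmxK mulmxDl mul1mx -[RHS]addr0 => /addrI/eqP.
have -> : (a *m b *m v^T = v 0 j *: a)%R.
  rewrite -mulmxA (_ : b *m v^T = (v 0 j)%:M)%R ?mul_mx_scalar //.
  by apply/matrixP=> i k; rewrite -rowE !ord1 !mxE eqxx mulr1n.
by rewrite scaler_eq0 (negPf vj) (negPf nza).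
Qed.

End GraphAutomorphism.

(** * Submaximality realised in the automorphism group *)

Lemma conj_autJ (gT : finGroupType) (G : {group gT}) :
  {in Aut G & G, forall a x, conj_aut G x ^ a = conj_aut G (a x)}.
Proof.
move=> a x AutGa Gx; have Gax : a x \in G by rewrite Aut_closed.
apply: (eq_Aut _ (Aut_aut _ _)); first by rewrite groupJ ?Aut_aut.
move=> y Gy; rewrite conj_autE //; pose z := (a^-1) y.
have Gz : z \in G by rewrite Aut_closed ?groupV.
have -> : y = a z by rewrite permKV.
rewrite permJ conj_autE // -!(autmE AutGa) morphJ //.
Qed.

(* The overgroup is Aut G, in which G embeds by conjugation; the pi-maximal
   subgroup is any one containing both the image of H and b. *)
Lemma pi_submaximal_of_Aut (gT : finGroupType) (G H : {group gT})
    (pi : nat_pred) (p : nat) (b : {perm gT}) :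
    'Z(G) = 1 -> H \subset G -> p \in pi -> p.-group H ->
    b \in Aut G -> p.-elt b -> {in H, forall x, b x \in H} ->
    (forall M : {group gT}, H \subset M -> M \subset G -> pi.-group M ->
       {in M, forall x, b x \in M} -> M :=: H) ->
  pi_submaximal pi G H.
Proof.
move=> Z1 sHG pi_p pH AutGb p_b bH maxH; split=> //.
pose i := restrm_morphism (normG G) (conj_aut_morphism G).
have inj_i : 'injm i.
  by rewrite ker_restrm ker_conj_aut -/(center G) Z1.
have iE : {in G, i =1 conj_aut G} by [].
have iJ : {in G, forall x, i x ^ b = i (b x)}.
  by move=> x Gx; rewrite !iE ?Aut_closed // conj_autJ.
have sIA : i @* G \subset Aut G by rewrite morphim_restrm; apply: Aut_conj_aut.
have nIA : i @* G <| Aut G.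
  rewrite /normal sIA; apply/subsetP=> a AutGa; rewrite inE.
  apply/subsetP=> _ /imsetP[_ /morphimP[x _ Gx ->] ->].
  by rewrite iE // conj_autJ // -iE ?mem_morphim ?Aut_closed.
have nHb : <[b]> \subset 'N(i @* H).
  rewrite cycle_subG inE; apply/subsetP=> _ /imsetP[_ /morphimP[x Gx Hx ->] ->].
  by rewrite iJ // mem_morphim ?bH // Aut_closed.
have piT : pi.-subgroup(Aut G) (i @* H <*> <[b]>).
  apply/andP; split.
    by rewrite join_subG cycle_subG AutGb (subset_trans (morphimS _ sHG)).
  rewrite norm_joinEr // pgroupM.
  by rewrite (pi_pgroup (morphim_pgroup _ pH)) // (pi_pgroup p_b).
have [K maxK] : {K : {group _} | [max K | pi.-subgroup(Aut G) K] &
    i @* H <*> <[b]> \subset K} by apply: maxgroup_exists.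
rewrite join_subG cycle_subG => /andP[sHK Kb].
have /andP[sKA piK] := maxgroupp maxK.
exists {perm gT}, [group of Aut G], K, [morphism of i]; split=> //.
  exact: normal_subnormal.
(* [M] is the trace of [K] on [G]; it is [b]-invariant because [K] contains [b], so [maxH]
   applies. *)
pose M := (i @*^-1 (i @* G :&: K))%G.
have iM : i @* M = i @* G :&: K by rewrite morphpreK ?subsetIl.
have sMG : M \subset G by rewrite subsetIl.
rewrite -iM (maxH M) //.
- rewrite -sub_morphim_pre // subsetI morphimS //.
- by rewrite -(injm_pgroup inj_i _ sMG) iM (pgroupS (subsetIr _ _)).
move=> x /morphpreP[Gx]; rewrite inE => /andP[_ Kix].
by apply/morphpreP; rewrite Aut_closed // inE mem_morphim ?Aut_closed // -iJ // groupJ.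
Qed.

(** * Submaximality of the Sylow 2-subgroups of [GL_3(2)] *)

Section GL32Submaximal.

Local Notation L := 'GL_3(2).
Implicit Types H M N : {group {'GL_3['F_2]}}.

Variable x : {'GL_3['F_2]}.

(** The conjugation by [x] is there to bring a given Sylow 2-subgroup back to itself after
    [inv_tr]. *)
Let graph g := inv_tr g ^ x.

Let graphM : {in L &, {morph graph : g h / g * h}}.
Proof. by move=> g h _ _; rewrite /graph inv_trM conjMg. Qed.

Canonical graph_morphism := Morphism graphM.

Let graph_inj : injective graph.
Proof. by move=> g h /conjg_inj/(can_inj inv_trK). Qed.

(** As [N] normalises the nontrivial ['O_2(N)], it fixes a nonzero row or a nonzero column, never
    both, and [inv_tr] exchanges the two. *)
Lemma fixes_row_graph N : #|N| = 24 -> fixes_row (graph @: N) = ~~ fixes_row N.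
Proof.
move=> oN.
have -> : graph @: N = (inv_tr @: N) :^ x by rewrite /conjugate -imset_comp.
rewrite fixes_rowJ.
have := fixes_row_norm_2group (pcore_pgroup 2 N) (pcore2_card24 oN) (gFnorm _ N).
have := not_fixes_row_both oN.
by case: (fixes_row N); case: (fixes_row _) => // /(_ isT isT).
Qed.

Lemma fixes_row_iter_graph N k : #|N| = 24 ->
  fixes_row (iter k graph @: N) = odd k (+) fixes_row N.
Proof.
elim: k N => [|k IHk] N oN.
  by congr fixes_row; rewrite -[RHS]imset_id; apply: eq_imset.
have -> : iter k.+1 graph @: N = iter k graph @: (graph_morphism @* N)%G.
  rewrite /= morphimEsub ?sub_GL32 // -imset_comp.
  by apply: eq_imset => g /=; rewrite -iterSr.
rewrite IHk /= morphimEsub ?sub_GL32 ?fixes_row_graph //; first by case: (odd k); case: fixes_row.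
by rewrite (card_imset _ graph_inj).
Qed.

End GL32Submaximal.

Lemma pi_submaximal_Sylow2_GL32 (H : {group {'GL_3['F_2]}}) :
  2.-Sylow('GL_3(2)) H -> pi_submaximal (pred2 2 3) 'GL_3(2) H.
Proof.
move=> sylH; have [sHL pH _] := and3P sylH.
have oH : #|H| = 8 by rewrite (card_Hall sylH) card_GL32 p_part.
have inv_trM' : {in 'GL_3(2) &, {morph inv_tr : g h / g * h}} by move=> g h _ _; apply: inv_trM.
pose HT := (Morphism inv_trM' @* H)%G.
have HTE : HT = inv_tr @: H :> {set _} by apply: morphimEsub; rewrite sub_GL32.
have sylHT : 2.-Sylow('GL_3(2)) HT.
  by rewrite pHallE sub_GL32 HTE (card_imset _ (can_inj inv_trK)) (card_Hall sylH) eqxx.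
have [x _ defH] := Sylow_trans sylHT sylH.
pose gr := graph_morphism x.
have inj_gr : injective gr by move=> g h /conjg_inj/(can_inj inv_trK).
pose a := perm inj_gr.
have aE g : a g = gr g by rewrite permE.
have AutLa : a \in Aut 'GL_3(2).
  rewrite inE; apply/andP; split; first by apply/subsetP=> g _; rewrite inE.
  apply/morphicP=> g h Lg Lh.
  by rewrite !aE morphM.
have Ha : {in H, forall h, a h \in H}.
  by move=> h Hh; rewrite aE defH; apply: (imset_f (conjg^~ x)); rewrite HTE imset_f.
(* The odd part of the order of [a]: [a ^+ m] is a 2-element, and an odd iterate still exchanges
   rows and columns. *)
set m := (#[a]`_2^')%N; have odd_m : odd m by rewrite odd_2'nat part_pnat.
have mE g : (a ^+ m) g = iter m gr g.
  by rewrite permX; apply: eq_iter.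
apply: (@pi_submaximal_of_Aut _ _ _ _ 2 (a ^+ m)) => //.
- exact: center_GL32.
- exact: groupX.
- rewrite /p_elt orderXdiv ?dvdn_part // -(partnC 2 (order_gt0 a)) mulnK ?part_gt0 //.
  exact: part_pnat.
- by move=> h; rewrite mE; elim: (m) => [|k IHk] Hh; rewrite ?iterS -?aE ?Ha ?IHk.
move=> M sHM _ piM Mb.
have chk : all (fun n => (8 %| n) ==> (pred2 2 3).-nat n ==> ((n == 8) || (n == 24)))
  (divisors 168) by vm_compute.
have := allP chk _ (card_sub_GL32 M); rewrite -{1}oH cardSg //.
rewrite -[_.-nat _]/(_.-group M) piM => /orP[] /eqP oM.
  by apply/esym/eqP; rewrite eqEcard sHM oM oH.
have defM : iter m gr @: M = M.
  rewrite -(eq_imset _ mE); apply/eqP; rewrite eqEcard card_imset ?leqnn ?andbT.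
    by apply/subsetP=> _ /imsetP[g Mg ->]; apply: Mb.
  exact: perm_inj.
have := fixes_row_iter_graph x m oM; rewrite defM odd_m.
by case: (fixes_row M).
Qed.

(** * The nonsplit extension *)

(** ['O_p(G)] lies in ['O_p(X)] when [G] is subnormal in [X], and a [pi]-maximal subgroup contains
    every normal [pi]-subgroup. *)
Lemma pi_submaximal_pcore_sub (gT : finGroupType) (pi : nat_pred) (p : nat)
    (G H : {group gT}) :
  p \in pi -> pi_submaximal pi G H -> 'O_p(G) \subset H.
Proof.
move=> pi_p [sHG [rT [X [K [i [inj_i snGX maxK iH]]]]]].
rewrite -(injmSK inj_i) ?pcore_sub // iH subsetI morphimS ?pcore_sub //=.
rewrite injm_pcore //; apply: subset_trans (subnormal_sub_pcore p snGX) _.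
by apply: normal_sub_max_pgroup maxK (pi_pgroup (pcore_pgroup p X) pi_p) (pcore_normal p X).
Qed.

(** [P] is built from [G] and [H = G :&: K] alone, so ['N_K(G)] normalises it and
    [pi_maximal_sub_of_norm] applies. *)
Lemma pi_submaximal_cent_sub (gT : finGroupType) (pi : nat_pred) (p : nat)
    (G H : {group gT}) (P := 'C_G('C_('O_p(G))(H))) :
    p \in pi -> G^`(1) = G ->
    simple_mod_pcore p G ->
  pi_submaximal pi G H -> pi.-group P -> P \subset H.
Proof.
move=> pi_p perfG simG [sHG [rT [X [K [i [inj_i snGX maxK iH]]]]]] piP.
have sPG : P \subset G := subsetIl _ _.
have iP : i @* P = 'C_(i @* G)('C_('O_p(i @* G))(i @* G :&: K)).
  rewrite injm_subcent //; last exact: subset_trans (subsetIl _ _) (pcore_sub _ _).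
  by rewrite injm_subcent // injm_pcore // iH.
rewrite -(injmSK inj_i) // iH subsetI morphimS //=.
apply: (@pi_maximal_sub_of_norm _ p pi (i @* G)%G K (i @* P)%G X) => //.
- by rewrite /= -morphim_der // perfG.
- move=> N nsN; have sN := normal_sub nsN.
  have defN : i @* (i @*^-1 N) = N by rewrite morphpreK.
  have nsM : i @*^-1 N <| i @*^-1 (i @* G) by rewrite morphpre_normal.
  rewrite morphimGK ?subsetIl // in nsM.
  case: (simG (i @*^-1 N)%G nsM) => [pM | defM]; first by left; rewrite -defN morphim_pgroup.
  by right; rewrite -defN /= defM.
- exact: morphimS.
- exact: morphim_pgroup.
have nK : 'N_K(i @* G) \subset 'N(i @* G) := subsetIr _ _.
rewrite /= -/P iP normsI // norms_cent // normsI ?gFnorm_trans // norms_cent //.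
by rewrite normsI // (subset_trans (subsetIl _ _)) ?normG.
Qed.

Section NonsplitExtension.

Import GRing.Theory.

Variables (gT : finGroupType) (G V : {group gT}).
Variables (f : {morphism G >-> {'GL_3['F_2]}}) (phi : {morphism V >-> 'rV['F_2]_3}).
Hypotheses (nsVG : V <| G) (im_f : f @* G = 'GL_3(2)) (ker_f : 'ker f = V).
Hypothesis iso_phi : isom V [set: 'rV['F_2]_3] phi.
Hypothesis phiJ : forall v g : gT, v \in V -> g \in G ->
  phi (v ^ g) = (phi v *m GLval (f g))%R.
Hypothesis nonsplit : ~~ [splits G, over V].
Implicit Types (M N : {group gT}).

Let inj_phi : 'injm phi. Proof. by have [] := isomP iso_phi. Qed.
Let im_phi : phi @* V = setT. Proof. by have [] := isomP iso_phi. Qed.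
Let sVG : V \subset G := normal_sub nsVG.

Lemma card_V : #|V| = 8.
Proof. by rewrite -(card_injm inj_phi (subxx _)) im_phi cardsT card_row3. Qed.

Lemma card_V1 : #|V^#| = 7.
Proof. by have /eqP := cardsD1 1 V; rewrite card_V group1 eqSS => /eqP. Qed.

Lemma pgroup_V : 2.-group V.
Proof. by rewrite /pgroup card_V. Qed.

Lemma abelian_V : abelian V.
Proof.
rewrite -(injm_abelian inj_phi (subxx _)) im_phi.
by apply/centsP=> u _ v _; apply: addrC.
Qed.

Lemma card_ext M : V \subset M -> M \subset G -> #|M| = (8 * #|f @* M|)%N.
Proof.
move=> sVM sMG; rewrite card_morphim ker_f (setIidPr sMG) -card_V.
by rewrite Lagrange.
Qed.

Lemma phi_eq0 v : v \in V -> (phi v == 0%R) = (v == 1).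
Proof.
move=> Vv; apply/eqP/eqP=> [phi0|->]; last exact: morph1.
by apply: (injmP inj_phi) => //; rewrite phi0 morph1.
Qed.

Lemma class_V v : v \in V -> v != 1 -> v ^: G = V^#.
Proof.
move=> Vv ntv; have Gv := subsetP sVG v Vv.
apply/setP=> w; rewrite !inE; apply/imsetP/andP=> [[g Gg ->]|[ntw Vw]].
  by rewrite conjg_eq1 memJ_norm // (subsetP (normal_norm nsVG)).
have [||l def_l] := @row_transitive (phi v) (phi w); rewrite ?phi_eq0 //.
have : l \in f @* G by rewrite im_f inE.
case/morphimP=> g _ Gg def_g; exists g => //.
have Vvg : v ^ g \in V by rewrite memJ_norm // (subsetP (normal_norm nsVG)).
by apply: (injmP inj_phi) => //; rewrite phiJ // -def_g -def_l.
Qed.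

Lemma cent_V : 'C_G(V) \subset V.
Proof.
apply/subsetP=> g /setIP[Gg cVg]; rewrite -ker_f; apply/kerP=> //.
apply: row_act_faithful => u _.
have : u \in phi @* V by rewrite im_phi inE.
case/morphimP=> v _ Vv ->; rewrite /row_act -phiJ //.
by rewrite conjgE -(centP cVg v Vv) mulKg.
Qed.

Lemma normal_sub_V N : N <| G -> N \subset V -> N :=: 1 \/ N :=: V.
Proof.
move=> nsNG sNV; have [-> | /trivgPn[n Nn ntn]] := eqVneq (N : {set _}) 1; first by left.
right; apply/eqP; rewrite eqEsubset sNV; apply/subsetP=> v Vv.
have [-> | ntv] := eqVneq v 1; first exact: group1.
have : v \in n ^: G by rewrite class_V ?(subsetP sNV) // !inE ntv.
by case/imsetP=> g Gg ->; rewrite memJ_norm // (subsetP (normal_norm nsNG)).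
Qed.

(** [V :&: M] is normal in [V * M = G] because [V] is abelian, so by irreducibility it is 1 or [V];
    the first is excluded by [nonsplit], as [M] would be a complement. *)
Lemma full_image M : M \subset G -> f @* M = 'GL_3(2) -> M :=: G.
Proof.
move=> sMG fM; have defG : V * M = G.
  by rewrite -ker_f -morphimK // fM -im_f morphimGK ?subsetIl.
have nsVM : V :&: M <| G.
  rewrite /normal subIset ?sVG //= -{1}defG mulG_subG.
  rewrite sub_abelian_norm ?abelian_V ?subsetIl //=.
  by rewrite normsI ?normG // (subset_trans sMG) ?normal_norm.
case: (normal_sub_V nsVM (subsetIl _ _)) => [tiVM | /setIidPl sVM].
  by case/negP: nonsplit; apply/splitsP; exists M; apply/complP.
by rewrite -defG mulSGid.
Qed.

Lemma nonsolvable_ext : ~~ solvable G.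
Proof.
by apply: contra nonsolvable_GL32 => /(morphim_sol f); rewrite im_f.
Qed.

(** A proper [M] has a proper, hence solvable, image in [L], and meets the kernel inside the abelian
    [V]. *)
Lemma minimal_nonsolvable_ext : minimal_nonsolvable G.
Proof.
split=> [|M prMG]; first exact: nonsolvable_ext.
have sMG := proper_sub prMG.
have solfM : solvable (f @* M).
  apply: solvable_proper_GL32; rewrite properEneq sub_GL32 andbT.
  by apply: contraTneq prMG => /full_image->; rewrite ?properxx.
have nsKM : 'ker_M f <| M.
  by rewrite -(ker_restrm sMG); apply: (ker_normal (restrm_morphism sMG f)).
rewrite (series_sol nsKM).
rewrite (isog_sol (first_isog_loc f sMG)) solfM andbT.
by apply: solvableS (abelian_sol abelian_V); rewrite -ker_f subsetIr.
Qed.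

Lemma normal_ext N : N <| G -> N \subset V \/ N :=: G.
Proof.
move=> nsNG; have sNG := normal_sub nsNG.
have nsfN : f @* N <| 'GL_3(2) by rewrite -im_f morphim_normal.
case: (normal_GL32 nsfN) => fN; last by right; apply: full_image.
by left; rewrite -ker_f ker_trivg_morphim sNG fN subxx.
Qed.

(** Being normal, ['Phi(G)] lies in [V] or is [G], and the latter would make [G] trivial. A maximal
    subgroup not containing [V] would map onto [L], against [full_image]. *)
Lemma Phi_ext : 'Phi(G) = V.
Proof.
apply/eqP; rewrite eqEsubset; apply/andP; split.
  case: (normal_ext (Phi_normal G)) => //= defPhi.
  have := @Phi_nongen _ G 1; rewrite joingG1 => /(_ defPhi); rewrite genGid => G1.
  by have := nonsolvable_ext; rewrite -G1 solvable1.
apply/bigcapsP=> M; case/predU1P=> [->// | maxM]; apply: contraT => not_sVM.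
have [prMG maxMG] := maxgroupP maxM; have sMG := proper_sub prMG.
have defG : V <*> M = G.
  apply/eqP; rewrite eqEproper join_subG sVG sMG; apply: contra not_sVM => prVM.
  by rewrite -(maxMG (V <*> M)%G prVM) ?joing_subl ?joing_subr.
move: prMG; rewrite full_image ?properxx // -im_f.
have <- : f @* (V <*> M) = f @* G by rewrite defG.
rewrite -ker_f norm_joinEr ?(subset_trans sMG) ?ker_norm //.
by rewrite morphimMl ?subsetIl // morphim_ker mul1g.
Qed.

Lemma pcore2_ext : 'O_2(G) = V.
Proof.
apply/eqP; rewrite eqEsubset pcore_max ?pgroup_V // andbT.
case: (normal_ext (pcore_normal 2 G)) => //= defO.
by have := nonsolvable_ext; rewrite -defO (pgroup_sol (pcore_pgroup 2 G)).
Qed.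

Lemma perfect_ext : G^`(1) = G.
Proof. by apply: full_image; rewrite ?der_sub // morphim_der // im_f perfect_GL32. Qed.

(** * Centralisers attached to a Sylow 2-subgroup of [G] *)

Section Sylow2.

Variable S : {group gT}.
Hypotheses (sVS : V \subset S) (sSG : S \subset G) (oS : #|S| = 64).

(** A 2-group fixes a nontrivial element of [V]. If ['C_V(S)] had order 4, any [x] in [V] outside it
    would have ['C_S[x]] centralising [V], hence of order at most 8, and at most 7 conjugates: 56 <
    64. If it were [V], then [S] would lie in [V]. *)
Lemma card_cent_V_Sylow2 : #|'C_V(S)| = 2.
Proof.
have pS : 2.-group S by rewrite /pgroup oS.
have nsVS : V <| S := normalS sVS sSG nsVG.
have ntV : V :!=: 1 by rewrite -cardG_gt1 card_V.
have ntW : 'C_V(S) != 1.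
  apply: contra (meet_center_nil (pgroup_nil pS) nsVS ntV) => /eqP W1.
  by rewrite -subG1 -W1 setIS ?subsetIr.
have oW : #|'C_V(S)| \in divisors 8.
  by rewrite -dvdn_divisors // -card_V cardSg ?subsetIl.
rewrite (_ : divisors 8 = [:: 1%N; 2; 4; 8]) // !inE in oW; case/or4P: oW.
- by rewrite -trivg_card1 (negPf ntW).
- by move/eqP.
- move/eqP=> oW4.
  have /subsetPn[x Vx Wx] : ~~ (V \subset 'C_V(S)).
    by apply: contraL (leqnn 8) => /subset_leq_card; rewrite oW4 card_V.
  have ntx : x != 1 by apply: contraNneq Wx => ->; apply: group1.
  have defV : 'C_V(S) <*> <[x]> = V.
    apply/eqP; rewrite eqEcard join_subG subsetIl cycle_subG Vx card_V /=.
    have dv : #|'C_V(S) <*> <[x]>| \in divisors 8.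
      by rewrite -dvdn_divisors // -card_V cardSg // join_subG subsetIl cycle_subG.
    have gt4 : 4 < #|'C_V(S) <*> <[x]>|.
      rewrite -oW4 proper_card // properEneq joing_subl andbT.
      by apply: contraNneq Wx => ->; rewrite (subsetP (joing_subr _ _)) ?cycle_id.
    have chk : all (fun n => (4 < n) ==> (8 <= n)) (divisors 8) by vm_compute.
    by have := allP chk _ dv; rewrite gt4.
  have sCV : 'C_S[x] \subset V.
    apply: subset_trans cent_V; rewrite subsetI subIset ?sSG //=.
    rewrite centsC -defV join_subG cycle_subG.
    rewrite (subset_trans (subsetIr V _)) ?centS ?subsetIl //=.
    by apply/centP=> y /setIP[_ /cent1P].
  have sxV : x ^: S \subset V^# by rewrite -(class_V Vx ntx) imsetS.
  have ltS : #|S| <= 8 * 7.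
    rewrite -(Lagrange (subsetIl S 'C[x])) index_cent1 leq_mul //.
      by rewrite -card_V subset_leq_card.
    by rewrite -card_V1 subset_leq_card.
  by rewrite oS in ltS.
- move/eqP=> oW8.
  have sVC : V \subset 'C(S).
    by apply/setIidPl/eqP; rewrite eqEcard subsetIl oW8 card_V.
  have sSV : S \subset V by apply: subset_trans cent_V; rewrite subsetI sSG centsC.
  by have := subset_leq_card sSV; rewrite oS card_V.
Qed.

(** ['C_V(S)] is generated by one [w] whose class is [V^#], so its centraliser has index 7 in a
    group of order 1344. *)
Lemma card_cent_cent_V_Sylow2 : #|'C_G('C_V(S))| = 192.
Proof.
have oG : #|G| = 1344 by rewrite (card_ext sVG) // im_f card_GL32.
have pW : prime #|'C_V(S)| by rewrite card_cent_V_Sylow2.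
have /cyclicP[w defW] := prime_cyclic pW.
have ntw : w != 1 by apply: contraTneq pW => w1; rewrite defW w1 cycle1 cards1.
have Vw : w \in V by rewrite -cycle_subG -defW subsetIl.
have := Lagrange (subsetIl G 'C[w]); rewrite defW cent_cycle index_cent1 class_V //.
rewrite card_V1 oG => def.
by apply/eqP; rewrite -(eqn_pmul2r (isT : 0 < 7)) def.
Qed.

End Sylow2.

End NonsplitExtension.

Theorem mainTheorem2 (gT : finGroupType) (G V : {group gT})
    (f : {morphism G >-> {'GL_3['F_2]}})
    (phi : {morphism V >-> 'rV['F_2]_3})
    (nsVG : V <| G)
    (im_f : f @* G = 'GL_3(2))
    (ker_f : 'ker f = V)
    (iso_phi : isom V [set: 'rV['F_2]_3] phi)
    (phiJ : forall v g : gT, v \in V -> g \in G ->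
       phi (v ^ g) = (phi v *m GLval (f g))%R)
    (nonsplit : ~~ [splits G, over V]) :
  [/\ minimal_nonsolvable G,
      'Phi(G) = V
    & forall H : {group {'GL_3['F_2]}}, 2.-Sylow('GL_3(2)) H ->
        pi_submaximal (pred2 2 3) 'GL_3(2) H /\
        ~ (exists K : {group gT},
             pi_submaximal (pred2 2 3) G K /\ f @* K = H)].
Proof.
split=> [||H sylH].
- exact: minimal_nonsolvable_ext nsVG im_f ker_f iso_phi phiJ nonsplit.
- exact: Phi_ext nsVG im_f ker_f iso_phi phiJ nonsplit.
split=> [|[K [smaxK fK]]]; first exact: pi_submaximal_Sylow2_GL32.
have defO := pcore2_ext nsVG im_f ker_f iso_phi phiJ nonsplit.
have sKG : K \subset G by case: smaxK.
have sVK : V \subset K by rewrite -defO; apply: pi_submaximal_pcore_sub smaxK.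
have oK : #|K| = 64.
  rewrite (card_ext ker_f iso_phi sVK sKG) fK (card_Hall sylH) card_GL32 p_part.
  by [].
have oP := card_cent_cent_V_Sylow2 nsVG im_f ker_f iso_phi phiJ sVK sKG oK.
(* This centraliser has order 192, that is 64 times 3, so it is a [{2,3}]-group and is forced into
   [K], of order only 64. *)
have : 'C_G('C_('O_2(G))(K)) \subset K.
  apply: (@pi_submaximal_cent_sub _ (pred2 2 3)) smaxK _ => //.
  - exact: perfect_ext nsVG im_f ker_f iso_phi phiJ nonsplit.
  - move=> N nsNG.
    case: (normal_ext nsVG im_f ker_f iso_phi phiJ nonsplit nsNG) => [sNV|]; last by right.
    by left; apply: pgroupS sNV (pgroup_V iso_phi).
  by rewrite /= defO /pgroup oP.
by move/subset_leq_card; rewrite /= defO oP oK.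
Qed.
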